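(* Let $n=1$, let $\mathcal{I}=\{0,1,\dots,N\}$ with $N\in\mathbb{N}$ finite, let the strong Atkinson condition (SAC) be satisfied, and let $M,L\in\mathbb{C}^{2\times2}$ satisfy $\operatorname{rank}(M,L)=2$ and $M\mathcal{J}M^*-L\mathcal{J}L^*=0$. Put $T_{M,L}:=\{\{\tilde z,\tilde f\}\in T_{\max}\mid M\hat z_0-L\hat z_{N+1}=0\}$. Then the following hold. (i) A linear relation $T_{M,L}$ given through $M,L\in\mathbb{C}^{2\times 2}$ with $\operatorname{rank}M=1=\operatorname{rank}L$ is a self-adjoint extension of $T_{\min}$ if and only if $T_{M,L}=T_{P,Q}:=\{\{\tilde z,\tilde f\}\in T_{\max}\mid P\hat z_0=0=Q\hat z_{N+1}\}$, where $$P=\begin{pmatrix}\cos\alpha_0&\sin\alpha_0\\0&0\end{pmatrix},\qquad Q=\begin{pmatrix}0&0\\-\sin\alpha_{N+1}&\cos\alpha_{N+1}\end{pmatrix},$$ for a unique pair $\alpha_0,\alpha_{N+1}\in[0,\pi)$. (ii) A linear relation $T_{M,L}$ given through $M,L\in\mathbb{C}^{2\times 2}$ with $\operatorname{rank}M=2=\operatorname{rank}L$ is a self-adjoint extension of $T_{\min}$ if and only if $T_{M,L}=T_{R,\beta}:=\{\{\tilde z,\tilde f\}\in T_{\max}\mid e^{i\beta}R\hat z_0=\hat z_{N+1}\}$ with a unique $\beta\in[0,\pi)$ and a symplectic matrix $R\in\mathbb{R}^{2\times2}$.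
   Context: Here $\mathcal{J}=\begin{pmatrix}0&1\\-1&0\end{pmatrix}$, $\mathcal{I}=\{0,\dots,N\}$, $\mathcal{I}^+=\{0,\dots,N+1\}$. For each $k\in\mathcal{I}$ let $\mathcal{S}_k,\Psi_k\in\mathbb{C}^{2\times2}$ satisfy $\mathcal{S}_k^*\mathcal{J}\mathcal{S}_k=\mathcal{J}$, $\Psi_k^*=\Psi_k$, $\Psi_k^*\mathcal{J}\Psi_k=0$, $\Psi_k\ge0$ (positive semidefinite). Put $\mathcal{V}_k=-\mathcal{J}\Psi_k\mathcal{S}_k$. The system $(S_\lambda)$ is $z_k=(\mathcal{S}_k+\lambda\mathcal{V}_k)z_{k+1}$, $k\in\mathcal{I}$, for $z:\mathcal{I}^+\to\mathbb{C}^2$. Let $\mathscr{L}(z)_k=\mathcal{J}(z_k-\mathcal{S}_kz_{k+1})$, $k\in\mathcal{I}$. Strong Atkinson condition (SAC): there is an interval $\{a,\dots,b\}\subseteq\mathcal{I}$ such that for every $\lambda\in\mathbb{C}$ every nontrivial solution $z$ of $(S_\lambda)$ satisfies $\sum_{k=a}^bz_k^*\Psi_kz_k>0$. Put $\langle z,u\rangle_\Psi=\sum_{k\in\mathcal{I}}z_k^*\Psi_ku_k$, $\|z\|_\Psi=\sqrt{\langle z,z\rangle_\Psi}$, and let $\tilde\ell^2_\Psi$ be the Hilbert space of equivalence classes of sequences $z:\mathcal{I}^+\to\mathbb{C}^2$ modulo $\{z:\|z\|_\Psi=0\}$. A linear relation is a linear subspace $T\subseteq\tilde\ell^2_\Psi\times\tilde\ell^2_\Psi$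 of pairs $\{\tilde z,\tilde f\}$; its adjoint is $T^*=\{\{\tilde y,\tilde g\}:\langle\tilde z,\tilde g\rangle_\Psi=\langle\tilde f,\tilde y\rangle_\Psi\ \forall\{\tilde z,\tilde f\}\in T\}$. $T$ is a self-adjoint extension of $T'$ if $T'\subseteq T=T^*$. $T_{\max}=\{\{\tilde z,\tilde f\}:\exists u\in\tilde z,\ \mathscr{L}(u)_k=\Psi_kf_k\ \forall k\in\mathcal{I}\}$. Under (SAC) this $u$ is unique for each pair $\{\tilde z,\tilde f\}\in T_{\max}$ and is denoted $\hat z$ (it is determined by the pair). $T_{\min}=\overline{T_0}$, where $T_0$ is the set of $\{\tilde z,\tilde f\}$ for which there is $u\in\tilde z$ with $u_0=0=u_{N+1}$ and $\mathscr{L}(u)_k=\Psi_kf_k$ for all $k\in\mathcal{I}$. A matrix $R\in\mathbb{R}^{2\times2}$ is symplectic if $R^\top\mathcal{J}R=\mathcal{J}$. $(M,L)$ denotes the $2\times4$ matrix with blocks $M$ and $L$. *)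

(* Defs.v *)
From HB Require Import structures.
From mathcomp Require Import all_boot all_order all_algebra.
From mathcomp Require Import complex ring.
From mathcomp Require Import boolp classical_sets reals trigo.

Set Implicit Arguments.
Unset Strict Implicit.
Unset Printing Implicit Defensive.

Import Order.TTheory GRing.Theory Num.Theory Num.Def.
Local Open Scope classical_set_scope.
Local Open Scope quotient_scope.
Local Open Scope complex_scope.
Local Open Scope ring_scope.
Local Open Scope sesquilinear_scope.

Definition mx2 {A : Type} (a b c d : A) : 'M[A]_2 :=
  \matrix_(i, j) if i == 0 then (if j == 0 then a else b)
                 else (if j == 0 then c else d).

Definition J2 {A : pzRingType} : 'M[A]_2 := mx2 0 1 (-1) 0.

Definition symplectic {R : pzRingType} (A : 'M[R]_2) : Prop :=
  A^T *m J2 *m A = J2.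

Definition sesq {R : realType} (A : 'M[R[i]]_2) (x y : 'cV[R[i]]_2) : R[i] :=
  (x ^t* *m A *m y) 0 0.

(* In the order of R[i], 0 <= w says that w is real and nonnegative. *)
Definition psd {R : realType} (A : 'M[R[i]]_2) : Prop :=
  A ^t* = A /\ forall x, 0 <= sesq A x x.

(* Indices of the coefficients run over 'I_N.+1 = {0, ..., N}, those of the
   sequences over 'I_N.+2 = {0, ..., N+1}. *)
Record symp_system (R : realType) (N : nat) := SympSystem {
  Smx : 'I_N.+1 -> 'M[R[i]]_2;
  Psi : 'I_N.+1 -> 'M[R[i]]_2;
  Smx_symp : forall k, (Smx k) ^t* *m J2 *m Smx k = J2;
  Psi_isotropic : forall k, (Psi k) ^t* *m J2 *m Psi k = 0;
  Psi_psd : forall k, psd (Psi k)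
}.

Definition cseq (R : realType) (N : nat) := {ffun 'I_N.+2 -> 'cV[R[i]]_2}.

(* k and k+1 as elements of {0, ..., N+1}. *)
Definition idx {N} (k : 'I_N.+1) : 'I_N.+2 := widen_ord (leqnSn N.+1) k.
Definition idxS {N} (k : 'I_N.+1) : 'I_N.+2 := lift ord0 k.

Section System.
Context {R : realType} {N : nat} (Sg : symp_system R N).
Local Notation C := R[i].
Local Notation cseq := (cseq R N).

Definition Vmx (k : 'I_N.+1) : 'M[C]_2 := - (J2 *m Psi Sg k *m Smx Sg k).

Definition solution (lam : C) (z : cseq) : Prop :=
  forall k, z (idx k) = (Smx Sg k + lam *: Vmx k) *m z (idxS k).

Definition strong_Atkinson : Prop :=
  exists a b : 'I_N.+1, (a <= b)%N /\
    forall (lam : C) (z : cseq), solution lam z -> z != 0 ->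
      0 < \sum_(k < N.+1 | (a <= k <= b)%N) sesq (Psi Sg k) (z (idx k)) (z (idx k)).

Definition opL (z : cseq) (k : 'I_N.+1) : 'cV[C]_2 :=
  J2 *m (z (idx k) - Smx Sg k *m z (idxS k)).

Definition semi_inner (z u : cseq) : C :=
  \sum_(k < N.+1) sesq (Psi Sg k) (z (idx k)) (u (idx k)).

Definition semi_norm (z : cseq) : C := sqrtC (semi_inner z z).

Definition nullseq : pred cseq := fun z => semi_norm z == 0.

Lemma sesqDl A (x y u : 'cV[C]_2) : sesq A (x + y) u = sesq A x u + sesq A y u.
Proof. by rewrite /sesq linearD map_mxD !mulmxDl mxE. Qed.

Lemma sesqDr A (u x y : 'cV[C]_2) : sesq A u (x + y) = sesq A u x + sesq A u y.
Proof. by rewrite /sesq mulmxDr mxE. Qed.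

Lemma sesqZl A a (x u : 'cV[C]_2) : sesq A (a *: x) u = conjC a * sesq A x u.
Proof. by rewrite /sesq linearZ map_mxZ -!scalemxAl mxE. Qed.

Lemma sesqZr A a (u x : 'cV[C]_2) : sesq A u (a *: x) = a * sesq A u x.
Proof. by rewrite /sesq -scalemxAr mxE. Qed.

Lemma dot_ge0 (v : 'cV[C]_2) : 0 <= (v ^t* *m v) 0 0.
Proof.
by rewrite mxE sumr_ge0 // => i _; rewrite !mxE mulrC mul_conjC_ge0.
Qed.

Lemma dot_eq0 (v : 'cV[C]_2) : (v ^t* *m v) 0 0 = 0 -> v = 0.
Proof.
rewrite mxE => /eqP; rewrite psumr_eq0; last first.
  by move=> i _; rewrite !mxE mulrC mul_conjC_ge0.
move=> /allP h; apply/matrixP => i j; rewrite ord1 mxE.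
have := h i (mem_index_enum _); rewrite /= !mxE mulrC mul_conjC_eq0.
by move/eqP.
Qed.

Lemma psd_null (A : 'M[C]_2) (x : 'cV[C]_2) :
  psd A -> sesq A x x = 0 -> A *m x = 0.
Proof.
move=> [hA pA] x0; set v := A *m x.
have h1 : sesq A v x = (v ^t* *m v) 0 0 by rewrite /sesq -mulmxA.
have h2 : sesq A x v = (v ^t* *m v) 0 0.
  by rewrite /sesq /v trmx_mul map_mxM hA.
set d := (v ^t* *m v) 0 0 in h1 h2.
have d0 : 0 <= d := dot_ge0 v.
set q := sesq A v v; have q0 : 0 <= q by apply: pA.
have key e : 0 < e -> d + d <= e * q.
  move=> e0; have := pA (x - e *: v).
  rewrite -scaleNr sesqDl !sesqDr !sesqZl !sesqZr x0 h1 h2 -/q add0r.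
  have -> : conjC (- e) = - e by rewrite conj_Creal // realN ger0_real // ltW.
  rewrite (_ : _ + _ = e * (e * q - (d + d))); last by ring.
  by rewrite pmulr_rge0 // subr_ge0.
apply: dot_eq0; apply/eqP; rewrite -/d eq_le d0 andbT.
have q1 : 0 < q + 1 by rewrite ltr_wpDl.
have [->//|dn0] := eqVneq d 0.
have dp : 0 < d by rewrite lt_def dn0.
have := key (d / (q + 1)) (divr_gt0 dp q1).
rewrite mulrAC ler_pdivlMr // mulrDr mulr1 mulrDl.
rewrite -subr_ge0 (_ : _ - _ = - (d * q + d + d)); last by ring.
rewrite oppr_ge0 => h; apply: le_trans h; rewrite -addrA ler_wpDl //.
  exact: mulr_ge0.
by rewrite lerDl.
Qed.

Lemma nullseqP (z : cseq) :
  reflect (forall k, Psi Sg k *m z (idx k) = 0) (nullseq z).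
Proof.
rewrite /nullseq /semi_norm sqrtC_eq0 psumr_eq0; last first.
  by move=> k _; case: (Psi_psd Sg k).
apply: (iffP allP) => [h k|h k _].
  by apply: psd_null; [exact: Psi_psd | apply/eqP/h; exact: mem_index_enum].
by apply/eqP; rewrite /sesq -mulmxA h mulmx0 mxE.
Qed.

Lemma nullseq_submod : submod_closed nullseq.
Proof.
split=> [|a x y /nullseqP hx /nullseqP hy].
  by apply/nullseqP => k; rewrite ffunE mulmx0.
apply/nullseqP => k; rewrite !ffunE mulmxDr -scalemxAr hx hy scaler0 addr0 //.
Qed.

HB.instance Definition _ :=
  GRing.isSubmodClosed.Build C cseq nullseq nullseq_submod.

Definition ell2 : Type :=
  Quotient.quot (GRing.ZmodClosed.clone cseq nullseq _).

HB.instance Definition _ := GRing.Zmodule.on ell2.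
HB.instance Definition _ := EqQuotient.on ell2.

Definition cls (z : cseq) : ell2 := \pi_(ell2) z.

Lemma clsP (z u : cseq) : cls z = cls u <-> semi_norm (z - u) = 0.
Proof.
rewrite /cls; split => [h|h]; last by apply/eqmodP; exact/eqP.
by apply/eqP; move/eqmodP: h.
Qed.

Lemma cls_repr (x : ell2) : cls (repr x) = x.
Proof. exact: reprK. Qed.

Lemma clsD (z u : cseq) : cls (z + u) = cls z + cls u.
Proof. exact: (raddfD (\pi_(ell2))). Qed.

Definition scale_ell2 (a : C) (x : ell2) : ell2 := cls (a *: repr x).

Lemma scale_cls a (z : cseq) : scale_ell2 a (cls z) = cls (a *: z).
Proof.
apply/eqmodP; rewrite /= /Quotient.equiv -scalerBr rpredZ //.
by have /eqmodP := cls_repr (cls z).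
Qed.

Fact scale_ell2A a b x : scale_ell2 a (scale_ell2 b x) = scale_ell2 (a * b) x.
Proof. by rewrite -(cls_repr x) !scale_cls scalerA. Qed.

Fact scale_ell21 : left_id 1 scale_ell2.
Proof. by move=> x; rewrite -(cls_repr x) scale_cls scale1r. Qed.

Fact scale_ell2Dr : right_distributive scale_ell2 +%R.
Proof.
move=> a x y; rewrite -(cls_repr x) -(cls_repr y).
by rewrite -clsD !scale_cls -clsD scalerDr.
Qed.

Fact scale_ell2Dl x : {morph scale_ell2^~ x : a b / a + b}.
Proof. by move=> a b; rewrite -(cls_repr x) !scale_cls -clsD scalerDl. Qed.

HB.instance Definition _ := GRing.Zmodule_isLmodule.Build C ell2
  scale_ell2A scale_ell21 scale_ell2Dr scale_ell2Dl.

Definition inner_ell2 (x y : ell2) : C := semi_inner (repr x) (repr y).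

Definition norm_ell2 (x : ell2) : C := sqrtC (inner_ell2 x x).

Lemma Psi_cls (z u : cseq) k :
  cls z = cls u -> Psi Sg k *m z (idx k) = Psi Sg k *m u (idx k).
Proof.
move=> /clsP/eqP/nullseqP/(_ k); rewrite !ffunE mulmxBr => /eqP.
by rewrite subr_eq0 => /eqP.
Qed.

Lemma inner_ell2E (z u : cseq) : inner_ell2 (cls z) (cls u) = semi_inner z u.
Proof.
apply: eq_bigr => k _; rewrite /sesq.
have hA : (Psi Sg k)^t* = Psi Sg k by case: (Psi_psd Sg k).
rewrite -!mulmxA (Psi_cls k (cls_repr (cls u))) !mulmxA.
by rewrite -hA -!map_mxM -!trmx_mul (Psi_cls k (cls_repr (cls z))).
Qed.

Definition linear_relation (T : set (ell2 * ell2)) : Prop :=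
  T 0 /\ forall (a : C) p q, T p -> T q -> T (a *: p + q).

Definition rel_adjoint (T : set (ell2 * ell2)) : set (ell2 * ell2) :=
  [set q | forall p, T p -> inner_ell2 p.1 q.2 = inner_ell2 p.2 q.1].

Definition rel_closure (T : set (ell2 * ell2)) : set (ell2 * ell2) :=
  [set p | forall eps : C, 0 < eps ->
     exists q, [/\ T q, norm_ell2 (p.1 - q.1) < eps & norm_ell2 (p.2 - q.2) < eps]].

Definition selfadjoint_extension (T T' : set (ell2 * ell2)) : Prop :=
  [/\ linear_relation T, T' `<=` T & T = rel_adjoint T].

(* u is a representative of p.1 with L(u) = Psi f, where f represents p.2;
   by Psi_cls this does not depend on the choice of f. *)
Definition lift_of (p : ell2 * ell2) (u : cseq) : Prop :=
  cls u = p.1 /\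
  forall k, opL u k = Psi Sg k *m (repr p.2 : cseq) (idx k).

Definition Tmax : set (ell2 * ell2) := [set p | exists u, lift_of p u].

Definition T0 : set (ell2 * ell2) :=
  [set p | exists u, [/\ lift_of p u, u ord0 = 0 & u ord_max = 0]].

Definition Tmin : set (ell2 * ell2) := rel_closure T0.

(* For p in Tmax, a sequence u with lift_of p u; by hat_unique it is the only
   one under the strong Atkinson condition. *)
Definition hat (p : ell2 * ell2) : cseq := xget 0 [set u | lift_of p u].

Lemma hat_unique (p : ell2 * ell2) (u : cseq) :
  strong_Atkinson -> lift_of p u -> hat p = u.
Proof.
move=> [a [b [_ sac]]] hu.
have [hc hL] : lift_of p (hat p).
  exact: (@xgetPex _ 0 [set v | lift_of p v] (ex_intro _ u hu)).
case: hu => uc uL; apply/eqP; rewrite -subr_eq0; set w := _ - _.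
have w0 : forall k, Psi Sg k *m w (idx k) = 0.
  by apply/nullseqP/eqP/clsP; rewrite hc uc.
apply: contraT => wn0.
suff /sac/(_ wn0) : solution 0 w.
  rewrite big1 ?ltxx // => k _.
  by rewrite /sesq -mulmxA w0 mulmx0 mxE.
move=> k; rewrite scale0r addr0.
have h : J2 *m (w (idx k) - Smx Sg k *m w (idxS k)) = 0 :> 'cV[C]_2.
  transitivity (opL (hat p) k - opL u k); last by rewrite hL uL subrr.
  rewrite /opL -mulmxBr; congr (_ *m _).
  by rewrite /w !ffunE mulmxBr !opprD addrACA.
have J2K : J2 *m J2 = - 1%:M :> 'M[C]_2.
  apply/matrixP => i j; rewrite !mxE !big_ord_recl big_ord0 !mxE /=.
  by case: i => [[|[|//]] ?]; case: j => [[|[|//]] ?] /=;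
     rewrite ?mul0r ?mulr0 ?mul1r ?mulr1 ?addr0 ?add0r ?oppr0.
apply/eqP; rewrite -subr_eq0; set v := _ - _; apply/eqP.
by rewrite -[v]opprK -[v]mul1mx -mulNmx -J2K -mulmxA h mulmx0 oppr0.
Qed.

Definition T_ML (M L : 'M[C]_2) : set (ell2 * ell2) :=
  [set p | Tmax p /\ M *m hat p ord0 - L *m hat p ord_max = 0].

Definition T_PQ (P Q : 'M[C]_2) : set (ell2 * ell2) :=
  [set p | [/\ Tmax p, P *m hat p ord0 = 0 & 0 = Q *m hat p ord_max]].

(* cos beta +i* sin beta is e^(i beta). *)
Definition T_Rbeta (A : 'M[R]_2) (beta : R) : set (ell2 * ell2) :=
  [set p | Tmax p /\
     (cos beta +i* sin beta) *: (map_mx (real_complex R) A *m hat p ord0)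
       = hat p ord_max].

End System.

Arguments cls {R N} Sg z.
Arguments Tmax {R N} Sg _.
Arguments T0 {R N} Sg _.
Arguments Tmin {R N} Sg _.
Arguments T_ML {R N} Sg M L.
Arguments T_PQ {R N} Sg P Q.
Arguments T_Rbeta {R N} Sg A beta.

Definition Pmx {R : realType} (alpha : R) : 'M[R[i]]_2 :=
  map_mx (real_complex R) (mx2 (cos alpha) (sin alpha) 0 0).

Definition Qmx {R : realType} (alpha : R) : 'M[R[i]]_2 :=
  map_mx (real_complex R) (mx2 0 0 (- sin alpha) (cos alpha)).

(* Main.v *)
(* By the Lagrange identity, pairs in Tmax satisfy <z,g> - <f,u> =
   z_0^* J u_0 - z_{N+1}^* J u_{N+1}.  Under (SAC) the Gram matrix of the
   solutions for lambda = 0 is invertible, so every pair of boundary values is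
   attained in Tmax, and the adjoint of T0 lies in Tmax.  Hence a boundary
   condition that is Lagrangian for this form defines a self-adjoint extension
   of Tmin; the kernel of (M, -L) is Lagrangian, being parametrised by
   x |-> (J M^* x, J L^* x).  So both sides of each equivalence always hold.
   If M = u m and L = v l have rank one, then m J m^* = l J l^* = 0, and such
   rows are multiples of real ones.  If M and L are invertible, W = L^-1 M
   satisfies W J W^* = J; dividing W by a square root e^(i beta) of its
   determinant gives A with A J A^* = J = A J A^T, hence A real.  Uniqueness
   holds because all boundary values are attained. *)

Require Import Defs.
From mathcomp Require Import all_boot all_order all_algebra complex.
From mathcomp Require Import boolp classical_sets reals trigo.
From mathcomp Require Import ring lra zify.

Set Implicit Arguments.
Unset Strict Implicit.
Unset Printing Implicit Defensive.

Import Order.TTheory GRing.Theory Num.Theory Num.Def.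
Local Open Scope classical_set_scope.
Local Open Scope complex_scope.
Local Open Scope ring_scope.
Local Open Scope sesquilinear_scope.

(** * The matrix J, conjugate transposes, Lagrangian conditions, one step of the Lagrange
    identity *)

Lemma J2K {A : pzRingType} : J2 *m J2 = - 1%:M :> 'M[A]_2.
Proof.
apply/matrixP => i j; rewrite !mxE !big_ord_recl big_ord0 !mxE /=.
by case: i => [[|[|//]] ?]; case: j => [[|[|//]] ?] /=;
   rewrite ?mul0r ?mulr0 ?mul1r ?mulr1 ?addr0 ?add0r ?oppr0.
Qed.

Lemma J2KM {A : pzRingType} n (B : 'M[A]_(2, n)) : J2 *m (J2 *m B) = - B.
Proof. by rewrite mulmxA J2K mulNmx mul1mx. Qed.

Section Adjoint.
Context {C : numClosedFieldType}.
Implicit Types m n p : nat.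

Lemma adjmxM m n p (A : 'M[C]_(m, n)) (B : 'M_(n, p)) :
  (A *m B)^t* = B^t* *m A^t*.
Proof. by rewrite trmx_mul map_mxM. Qed.

Lemma adjmxB m n (A B : 'M[C]_(m, n)) : (A - B)^t* = A^t* - B^t*.
Proof. by rewrite linearB map_mxB. Qed.

Lemma adjmxD m n (A B : 'M[C]_(m, n)) : (A + B)^t* = A^t* + B^t*.
Proof. by rewrite linearD map_mxD. Qed.

Lemma adjmxZ m n a (A : 'M[C]_(m, n)) : (a *: A)^t* = conjC a *: A^t*.
Proof. by rewrite linearZ map_mxZ. Qed.

Lemma adjmx0 m n : (0 : 'M[C]_(m, n))^t* = 0.
Proof. by rewrite linear0 map_mx0. Qed.

Lemma adjmx1 n : (1%:M : 'M[C]_n)^t* = 1%:M.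
Proof. by rewrite trmx1 map_mx1. Qed.

(** The boundary term of the Lagrange identity: [a], [c] are values at index 0, [b], [d] at N+1. *)
Definition boundary_form (a b c d : 'cV[C]_2) : C :=
  (a^t* *m J2 *m c) 0 0 - (b^t* *m J2 *m d) 0 0.

(** Isotropy and maximality in one equivalence: [K] is its own orthogonal complement. *)
Definition lagrangian (K : 'cV[C]_2 -> 'cV[C]_2 -> Prop) : Prop :=
  forall c d, K c d <-> forall a b, K a b -> boundary_form a b c d = 0.

Lemma adjmx_J2 : (J2 : 'M[C]_2)^t* = - J2.
Proof.
apply/matrixP => i j; rewrite !mxE.
by case: i => [[|[|//]] ?]; case: j => [[|[|//]] ?] /=;
   rewrite ?rmorphN ?rmorph0 ?rmorph1 ?opprK ?oppr0.
Qed.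

Lemma adjmx_unit n (A : 'M[C]_n) : (A^t* \in unitmx) = (A \in unitmx).
Proof. by rewrite map_unitmx unitmx_tr. Qed.

Lemma adjmx_scalar_col n (x : 'cV[C]_n) (y : 'cV[C]_n) :
  (x^t* *m y) 0 0 = conjC ((y^t* *m x) 0 0).
Proof.
by rewrite -[x in y^t* *m x]trmxCK -adjmxM !mxE conjCK.
Qed.

Lemma adjmx_mul_eq0 n (y : 'cV[C]_n) :
  (forall x : 'cV_n, (x^t* *m y) 0 0 = 0) -> y = 0.
Proof.
move=> h; apply/colP => i; have := h (delta_mx i 0).
by rewrite trmx_delta map_delta_mx -rowE !mxE.
Qed.

(** [B *m D = 0] and both ranks are two, so in dimension four the kernel of [B] is the range of [D].
    Pairing (c, d) with [D *m x] amounts to pairing [M *m c - L *m d] with [x], which gives both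
    directions. *)
Lemma kernel_lagrangian (M L : 'M[C]_2) :
  \rank (row_mx M L) = 2%N -> M *m J2 *m M^t* - L *m J2 *m L^t* = 0 ->
  lagrangian (fun a b => M *m a - L *m b = 0).
Proof.
move=> rk hML.
pose B := row_mx M (- L); pose D := col_mx (J2 *m M^t*) (J2 *m L^t*).
have BE a b : B *m col_mx a b = M *m a - L *m b.
  by rewrite mul_row_col mulNmx.
have BD : B *m D = 0 by rewrite BE !mulmxA.
have rkB : \rank B = 2%N.
  apply/eqP; rewrite eqn_leq rank_leq_row -{1}rk.
  have -> : row_mx M L = B *m block_mx 1%:M 0 0 (- 1%:M).
    by rewrite mul_row_block !mulmx0 mulmx1 mulNmx mulmxN opprK mulmx1 addr0 add0r.
  exact: mxrankM_maxl.
have rkD : \rank D = 2%N.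
  apply/eqP; rewrite eqn_leq rank_leq_col -{1}rk.
  rewrite -mxrank_tr -(mxrank_map conjC).
  have -> : (row_mx M L)^t* = block_mx (- J2) 0 0 (- J2) *m D.
    rewrite mul_block_col !mulNmx !J2KM !opprK !mul0mx addr0 add0r.
    by rewrite tr_row_mx map_col_mx.
  exact: mxrankM_maxr.
have onto c d : M *m c - L *m d = 0 ->
    exists x, c = J2 *m M^t* *m x /\ d = J2 *m L^t* *m x.
  rewrite -BE => Bv.
  have sDK : (D^T <= kermx B^T)%MS.
    by apply/sub_kermxP; rewrite -trmx_mul BD trmx0.
  have /submxP [x hx] : ((col_mx c d)^T <= D^T)%MS.
    have : (kermx B^T <= D^T)%MS.
      have [_ <-] := mxrank_leqif_sup sDK.
      by rewrite mxrank_ker !mxrank_tr rkB rkD.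
    by apply: submx_trans; apply/sub_kermxP; rewrite -trmx_mul Bv trmx0.
  exists x^T; apply: eq_col_mx; rewrite -mul_col_mx.
  by apply: trmx_inj; rewrite hx trmx_mul trmxK.
have entryB (u v : 'M[C]_1) : u 0 0 - v 0 0 = (u - v) 0 0 by rewrite !mxE.
move=> c d; split=> [/onto [x [-> ->]] a b Kab|h].
  rewrite /boundary_form entryB -!mulmxA !J2KM !mulmxN opprK addrC !mulmxA.
  by rewrite -!adjmxM -mulmxBl -adjmxB -opprB Kab oppr0 adjmx0 mul0mx mxE.
apply: adjmx_mul_eq0 => x.
rewrite -(h (J2 *m M^t* *m x) (J2 *m L^t* *m x)); last first.
  by rewrite !mulmxA -mulmxBl hML mul0mx.
rewrite /boundary_form entryB !adjmxM !trmxCK adjmx_J2.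
by rewrite !(mulmxN, mulNmx) -!mulmxA !J2KM !mulmxN !opprK mulmxBr.
Qed.

End Adjoint.

(* Since J Psi f is isotropic for J, the product of the two equations vanishes
   and only boundary terms survive the summation. *)
Lemma lagrange_step {C : numClosedFieldType} m p (S P : 'M[C]_2)
    (z z' f : 'M[C]_(2, m)) (u u' g : 'M[C]_(2, p)) :
  S^t* *m J2 *m S = J2 -> P^t* = P -> P^t* *m J2 *m P = 0 ->
  J2 *m (z - S *m z') = P *m f -> J2 *m (u - S *m u') = P *m g ->
  z^t* *m P *m g - f^t* *m P *m u = z^t* *m J2 *m u - z'^t* *m J2 *m u'.
Proof.
move=> symS hP iso hz hu.
have hSz : S *m z' = z + J2 *m (P *m f) by rewrite -hz J2KM opprB addrC subrK.
have hSu : S *m u' = u + J2 *m (P *m g) by rewrite -hu J2KM opprB addrC subrK.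
have -> : z'^t* *m J2 *m u' = (S *m z')^t* *m J2 *m (S *m u').
  by rewrite -[in LHS]symS adjmxM !mulmxA.
have fg0 : f^t* *m (P *m (J2 *m (P *m g))) = 0.
  by rewrite -{1}hP (mulmxA J2) (mulmxA (P^t* )) (mulmxA (P^t* )) iso mul0mx mulmx0.
rewrite hSz hSu adjmxD !adjmxM hP adjmx_J2.
rewrite !(mulmxDl, mulmxDr, mulmxN, mulNmx, opprK) -!mulmxA !J2KM.
rewrite !(mulmxN, opprK) fg0.
set a := _ *m (J2 *m u); set b := _ *m (P *m u); set c := _ *m (P *m g).
by rewrite addr0 -addrA opprD addrA subrr add0r opprB.
Qed.

(** * Inhomogeneous solutions, Green's formula and the adjoint of [T0] *)

Section LinearSystem.
Context {R : realType} {N : nat} (Sg : symp_system R N).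
Local Notation C := R[i].
Local Notation cseq := (cseq R N).
Local Notation S := (Smx Sg).
Local Notation P := (Psi Sg).

Lemma Psi_adj k : (P k)^t* = P k.
Proof. by case: (Psi_psd Sg k). Qed.

(** Allows [m] columns, so that fundamental matrices and single sequences share the same lemmas. *)
Definition solves {m} (F Z : 'I_N.+2 -> 'M[C]_(2, m)) : Prop :=
  forall k, J2 *m (Z (idx k) - S k *m Z (idxS k)) = P k *m F (idx k).

(** The equation reads z_k = S_k z_(k+1) - J Psi_k f_k, a recursion downwards from N+1. *)
Lemma backward_solution m (F : 'I_N.+2 -> 'M[C]_(2, m)) (B : 'M[C]_(2, m)) :
  exists Z : 'I_N.+2 -> 'M[C]_(2, m), Z ord_max = B /\ solves F Z.
Proof.
(* [g j] is the value at index N+1-j; passing from j' to j'+1 uses the coefficients at k = N-j'. *)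
pose g := fix g (j : nat) : 'M[C]_(2, m) := if j is j'.+1 then
  let k := inord (N - j') in
  S k *m g j' - J2 *m (P k *m F (idx k)) else B.
exists (fun i => g (N.+1 - i)%N); split; first by rewrite /= subnn.
move=> k; rewrite /= /bump /= add1n subSS subSn -1?ltnS //=.
rewrite subKn -1?ltnS // inord_val addrC addKr.
by rewrite -mulmxN J2KM opprK.
Qed.

Lemma lagrange_identity m p (Z F : 'I_N.+2 -> 'M[C]_(2, m))
    (U G : 'I_N.+2 -> 'M[C]_(2, p)) :
  solves F Z -> solves G U ->
  \sum_k ((Z (idx k))^t* *m P k *m G (idx k)
          - (F (idx k))^t* *m P k *m U (idx k)) =
  (Z ord0)^t* *m J2 *m U ord0 - (Z ord_max)^t* *m J2 *m U ord_max.
Proof.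
move=> hZ hU; pose w i := (Z i)^t* *m J2 *m U i.
rewrite (eq_bigr (fun k => w (idx k) - w (idxS k))); last first.
  move=> k _; apply: lagrange_step (hZ k) (hU k); first exact: Smx_symp.
    exact: Psi_adj.
  exact: Psi_isotropic.
rewrite big_split /= sumrN big_ord_recl [X in _ - X]big_ord_recr /=.
rewrite (_ : idx ord0 = ord0); last exact: val_inj.
rewrite (_ : idxS ord_max = ord_max); last exact: val_inj.
rewrite (eq_bigr (fun i : 'I_N => w (idxS (widen_ord (leqnSn N) i)))).
  by rewrite opprD addrACA addrA [X in X + _]addrAC addrK.
by move=> i _; congr (w _); exact: val_inj.
Qed.

Lemma solvesMr m p (F Z : 'I_N.+2 -> 'M[C]_(2, m)) (A : 'M_(m, p)) :
  solves F Z -> solves (fun i => F i *m A) (fun i => Z i *m A).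
Proof. by move=> h k; rewrite !mulmxA -h -mulmxBl mulmxA. Qed.

Lemma solvesD m (F Z G U : 'I_N.+2 -> 'M[C]_(2, m)) :
  solves F Z -> solves G U ->
  solves (fun i => F i + G i) (fun i => Z i + U i).
Proof.
move=> hZ hU k; rewrite /= [RHS]mulmxDr -hZ -hU -mulmxDr; congr (_ *m _).
by rewrite mulmxDr opprD addrACA.
Qed.

Lemma solvesB m (F Z G U : 'I_N.+2 -> 'M[C]_(2, m)) :
  solves F Z -> solves G U ->
  solves (fun i => F i - G i) (fun i => Z i - U i).
Proof.
move=> hZ hU k; rewrite /= [RHS]mulmxBr -hZ -hU -mulmxBr; congr (_ *m _).
by rewrite mulmxBr !opprD addrACA.
Qed.

Lemma homogeneous_solution (z : cseq) :
  solves (fun=> 0) z -> solution Sg 0 z.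
Proof.
move=> h k; rewrite scale0r addr0; apply/eqP; rewrite -subr_eq0 -oppr_eq0.
by rewrite -J2KM h !mulmx0.
Qed.

Lemma psd_term_ge0 k (x : 'cV[C]_2) : 0 <= sesq (P k) x x.
Proof. by case: (Psi_psd Sg k). Qed.

(** The Atkinson condition at lambda = 0 makes the sum over {a, ..., b} positive; the other terms
    are nonnegative. *)
Lemma semi_inner_gt0 (z : cseq) :
  strong_Atkinson Sg -> solves (fun=> 0) z -> z != 0 ->
  0 < semi_inner Sg z z.
Proof.
move=> [a [b [_ sac]]] /homogeneous_solution hz zn0.
apply: lt_le_trans (sac _ _ hz zn0) _.
rewrite /semi_inner [leRHS](bigID (fun k : 'I_N.+1 => (a <= k <= b)%N)) /=.
by rewrite lerDl sumr_ge0 // => k _; apply: psd_term_ge0.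
Qed.

(* X is the fundamental matrix normalised at N+1, and Z the response to
   X with zero data at N+1; the Lagrange identity gives
   - G = Z_0^* J X_0 for the Gram matrix G of X, so that both are invertible. *)
Lemma fundamental_pair : strong_Atkinson Sg ->
  exists X Z : 'I_N.+2 -> 'M[C]_2,
    [/\ X ord_max = 1%:M /\ solves (fun=> 0) X,
        Z ord_max = 0 /\ solves X Z,
        \sum_k (X (idx k))^t* *m P k *m X (idx k) \in unitmx &
        Z ord0 \in unitmx].
Proof.
move=> sac.
have [X [X1 hX]] := backward_solution (fun=> 0) 1%:M.
have [Z [Z0 hZ]] := backward_solution X 0.
exists X, Z; set G := \sum_k _.
have GE : - G = (Z ord0)^t* *m (J2 *m X ord0).
  have := lagrange_identity hZ hX.
  rewrite Z0 adjmx0 !mul0mx subr0 -mulmxA => <-.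
  by rewrite -sumrN; apply: eq_bigr => k _; rewrite mulmx0 sub0r.
have Gu : G \in unitmx.
  (* A row [v] killed by [G] gives a homogeneous solution [X *m v^t*] of zero seminorm, hence zero;
     its value at N+1 is [v^t*]. *)
  rewrite -row_free_unit; apply: inj_row_free => v vG.
  pose z : cseq := [ffun i => X i *m v^t*].
  have hz : solves (fun=> 0) z.
    move=> k; rewrite !ffunE.
    by have := solvesMr (v^t*) hX k; rewrite !mul0mx.
  have zz : semi_inner Sg z z = 0.
    transitivity ((v *m G *m v^t*) 0 0); last by rewrite vG mul0mx mxE.
    rewrite mulmx_sumr mulmx_suml summxE; apply: eq_bigr => k _.
    by rewrite /sesq !ffunE adjmxM trmxCK !mulmxA.
  have [z0|/(semi_inner_gt0 sac hz)] := eqVneq z 0; last by rewrite zz ltxx.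
  have := congr1 (fun u : cseq => u ord_max) z0.
  by rewrite !ffunE X1 mul1mx => /(congr1 (fun u => u^t*)); rewrite trmxCK adjmx0.
split=> //; rewrite -adjmx_unit.
have : - G \in unitmx by rewrite -scaleN1r unitmxZ // unitrN1.
by rewrite GE unitmx_mul => /andP[].
Qed.

Lemma green_formula (z f u g : cseq) : solves f z -> solves g u ->
  semi_inner Sg z g - semi_inner Sg f u =
  boundary_form (z ord0) (z ord_max) (u ord0) (u ord_max).
Proof.
move=> hz hu; rewrite /semi_inner -sumrB /boundary_form.
transitivity (((z ord0)^t* *m J2 *m u ord0
    - (z ord_max)^t* *m J2 *m u ord_max) 0 0); last by rewrite !mxE.
rewrite -(lagrange_identity hz hu) summxE.
by apply: eq_bigr => k _; rewrite [RHS]mxE [X in _ = _ + X]mxE.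
Qed.

Lemma solves_cls (z f g : cseq) :
  cls Sg f = cls Sg g -> solves f z -> solves g z.
Proof. by move=> fg h k; rewrite h (Psi_cls k fg). Qed.

Lemma lift_ofP (p : ell2 Sg * ell2 Sg) (u : cseq) :
  lift_of p u <-> cls Sg u = p.1 /\ solves (repr p.2 : cseq) u.
Proof. by split=> -[]. Qed.

Lemma lift_of_cls (z f : cseq) :
  solves f z -> lift_of (cls Sg z, cls Sg f) z.
Proof.
by move=> h; split=> //; apply: solves_cls h; rewrite cls_repr.
Qed.

Lemma green_ell2 (p q : ell2 Sg * ell2 Sg) (u v : cseq) :
  lift_of p u -> lift_of q v ->
  inner_ell2 p.1 q.2 - inner_ell2 p.2 q.1 =
  boundary_form (u ord0) (u ord_max) (v ord0) (v ord_max).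
Proof.
case: p q => [p1 p2] [q1 q2] /lift_ofP [/= <- hu] /lift_ofP [/= <- hv].
by rewrite -(green_formula hu hv) -!inner_ell2E !cls_repr.
Qed.

Lemma hat_lift p u : strong_Atkinson Sg -> @lift_of R N Sg p u ->
  lift_of p (hat p).
Proof. by move=> sac hu; rewrite (hat_unique sac hu). Qed.

(** [X *m b] has the right value at N+1; adding [Z *m e] keeps it and, [Z ord0] being invertible,
    corrects the value at 0. *)
Lemma boundary_values_onto (a b : 'cV[C]_2) : strong_Atkinson Sg ->
  exists p, [/\ Tmax Sg p, hat p ord0 = a & hat p ord_max = b].
Proof.
move=> sac; have [X [Z [[X1 hX] [Z0 hZ] _ Zu]]] := fundamental_pair sac.
pose e := invmx (Z ord0) *m (a - X ord0 *m b).
pose z : cseq := [ffun i => X i *m b + Z i *m e].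
pose f : cseq := [ffun i => X i *m e].
have hz : solves f z.
  move=> k; rewrite !ffunE.
  by have := solvesD (solvesMr b hX) (solvesMr e hZ) k; rewrite mul0mx add0r.
exists (cls Sg z, cls Sg f); have hl := lift_of_cls hz.
rewrite (hat_unique sac hl) !ffunE X1 Z0 mul1mx mul0mx addr0.
split=> //; first by exists z.
by rewrite /e mulKVmx // addrC subrK.
Qed.

Lemma semi_innerBl (x y u : cseq) :
  semi_inner Sg (x - y) u = semi_inner Sg x u - semi_inner Sg y u.
Proof.
rewrite /semi_inner -sumrB; apply: eq_bigr => k _.
by rewrite !ffunE -scaleN1r sesqDl sesqZl rmorphN1 mulN1r.
Qed.

Lemma semi_innerDr (x y u : cseq) :
  semi_inner Sg u (x + y) = semi_inner Sg u x + semi_inner Sg u y.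
Proof.
by rewrite -big_split; apply: eq_bigr => k _; rewrite !ffunE sesqDr.
Qed.

Lemma semi_innerZr a (x u : cseq) :
  semi_inner Sg u (a *: x) = a * semi_inner Sg u x.
Proof.
by rewrite mulr_sumr; apply: eq_bigr => k _; rewrite !ffunE sesqZr.
Qed.

Lemma semi_innerBr (x y u : cseq) :
  semi_inner Sg u (x - y) = semi_inner Sg u x - semi_inner Sg u y.
Proof. by rewrite -scaleN1r semi_innerDr semi_innerZr mulN1r. Qed.

(* For w solving the equation of q with zero data at N+1, the functional
   f |-> <f, w - y> vanishes on the range of T0, the orthogonal complement of
   the homogeneous solutions; hence w - y is equivalent to one of those. *)
Lemma T0_adjoint_sub_Tmax : strong_Atkinson Sg ->
  rel_adjoint (T0 Sg) `<=` Tmax Sg.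
Proof.
move=> sac q hq.
have [X [Z [[X1 hX] [Z0 hZ] Gu Zu]]] := fundamental_pair sac.
set G := \sum_k _ in Gu.
pose y : cseq := repr q.1; pose g : cseq := repr q.2.
have [w' [w0 hw']] := backward_solution g 0.
pose w : cseq := [ffun i => w' i]; have hw : solves g w.
  by move=> k; rewrite !ffunE.
pose d : cseq := w - y.
(* By [hq], <f, y> = <z, g>; Green's formula gives <f, w> the same value, since [z] vanishes at both
   ends. *)
have orth (f z : cseq) : solves f z -> z ord0 = 0 -> z ord_max = 0 ->
    semi_inner Sg f d = 0.
  move=> hz za zb.
  have := hq (cls Sg z, cls Sg f).
  rewrite /= -{1}[q.2]cls_repr -{1}[q.1]cls_repr !inner_ell2E => h.
  have {}h : semi_inner Sg z g = semi_inner Sg f y.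
    by apply: h; exists z; split=> //; exact: lift_of_cls.
  rewrite /d semi_innerBr -h; apply/eqP; rewrite subr_eq0 eq_sym -subr_eq0.
  by rewrite (green_formula hz hw) /boundary_form za zb !adjmx0 !mul0mx subrr.
pose V e : cseq := [ffun i => X i *m e].
have hV e : solves (fun=> 0) (V e).
  by move=> k; rewrite !ffunE; have := solvesMr e hX k; rewrite mul0mx.
pose r := \sum_k (X (idx k))^t* *m P k *m d (idx k).
(* Normal equations: [V eta] is the orthogonal projection of [d] on the homogeneous solutions. *)
pose eta := invmx G *m r.
have Vr e (u : cseq) : semi_inner Sg (V e) u =
    (e^t* *m \sum_k (X (idx k))^t* *m P k *m u (idx k)) 0 0.
  rewrite mulmx_sumr summxE; apply: eq_bigr => k _.
  by rewrite /sesq ffunE adjmxM !mulmxA.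
have VV e : semi_inner Sg (V e) (V eta) = semi_inner Sg (V e) d.
  rewrite !Vr -/r; congr ((_ *m _) 0 0).
  rewrite (eq_bigr (fun k => (X (idx k))^t* *m P k *m X (idx k) *m eta)).
    by rewrite -mulmx_suml /eta mulKVmx.
  by move=> k _; rewrite ffunE mulmxA.
have dV f : semi_inner Sg f (d - V eta) = 0.
  have [z' [zb hz']] := backward_solution f 0.
  (* Subtracting [Z *m e] cancels the value at 0, so [f - V e] is in the range of [T0], to which [d]
     and [V eta] are both orthogonal; [VV] handles the remainder [V e]. *)
  pose e := invmx (Z ord0) *m z' ord0.
  pose z : cseq := [ffun i => z' i - Z i *m e].
  have hz : solves (f - V e) z.
    by move=> k; have := solvesB hz' (solvesMr e hZ) k; rewrite !ffunE.
  have za : z ord0 = 0 by rewrite ffunE mulKVmx ?subrr.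
  have zb' : z ord_max = 0 by rewrite ffunE zb Z0 mul0mx subrr.
  have h1 := orth _ _ hz za zb'.
  have h2 : semi_inner Sg (f - V e) (V eta) = 0.
    have h0 : solves (0 : cseq) (V eta) by move=> k; rewrite hV ffunE.
    have := green_formula hz h0.
    rewrite /boundary_form za zb' !adjmx0 !mul0mx subrr.
    have -> : semi_inner Sg z 0 = 0.
      by apply: big1 => k _; rewrite /sesq [(0 : cseq) _]ffunE mulmx0 mxE.
    by rewrite sub0r => /eqP; rewrite oppr_eq0 => /eqP.
  move: h1 h2; rewrite semi_innerBr !semi_innerBl VV => h1 h2.
  by apply/eqP; rewrite subr_eq0; apply/eqP/(addIr (- semi_inner Sg (V e) d));
     rewrite h1 h2.
exists (w - V eta); apply/lift_ofP; split.
  rewrite -[q.1]cls_repr; apply/clsP.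
  have -> : w - V eta - repr q.1 = d - V eta by rewrite /d addrAC.
  by rewrite /semi_norm dV sqrtC0.
by move=> k; have := solvesB hw (hV eta) k; rewrite subr0 !ffunE.
Qed.

End LinearSystem.

(** * Cauchy-Schwarz, closedness of adjoints, self-adjointness of Lagrangian restrictions *)

(** The left side expands the squared seminorm of <v,v> u - <v,u> v, with y = <v,v>, a = <u,u>, b =
    <u,v>, b' = <v,u>; its sign gives Cauchy-Schwarz. *)
Lemma discriminant_identity {A : comPzRingType} (a b b' y : A) :
  y * (y * a - b * b') - b' * (y * b - b * y) = y * (a * y - b * b').
Proof. by ring. Qed.

Lemma small_eq0 {C : numFieldType} (d a b : C) : 0 <= a -> 0 <= b ->
  (forall e, 0 < e -> `|d| <= a * e + b * e) -> d = 0.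
Proof.
move=> a0 b0 h; apply/eqP; apply: contraT; rewrite -normr_gt0 => d0.
have n1 : 0 < a + b + 1 by rewrite ltr_wpDl // addr_ge0.
have := h _ (divr_gt0 d0 n1).
rewrite -mulrDl mulrA ler_pdivlMr // mulrC ler_pM2r //.
by rewrite -subr_ge0 opprD addrA subrr sub0r lerNr oppr0 ler10.
Qed.

Section SelfAdjoint.
Context {R : realType} {N : nat} (Sg : symp_system R N).
Local Notation C := R[i].
Local Notation cseq := (cseq R N).

Lemma semi_innerC (x y : cseq) : semi_inner Sg x y = conjC (semi_inner Sg y x).
Proof.
rewrite rmorph_sum; apply: eq_bigr => k _; rewrite /sesq -mulmxA.
by rewrite adjmx_scalar_col adjmxM Psi_adj.
Qed.

Lemma semi_innerZl a (x u : cseq) :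
  semi_inner Sg (a *: x) u = conjC a * semi_inner Sg x u.
Proof.
by rewrite mulr_sumr; apply: eq_bigr => k _; rewrite !ffunE sesqZl.
Qed.

Lemma semi_inner_ge0 (x : cseq) : 0 <= semi_inner Sg x x.
Proof. by apply: sumr_ge0 => k _; apply: psd_term_ge0. Qed.

Lemma inner_ell2Dr (u x y : ell2 Sg) :
  inner_ell2 u (x + y) = inner_ell2 u x + inner_ell2 u y.
Proof.
rewrite -(cls_repr u) -(cls_repr x) -(cls_repr y) -clsD !inner_ell2E.
exact: semi_innerDr.
Qed.

Lemma inner_ell2Zr a (u x : ell2 Sg) :
  inner_ell2 u (a *: x) = a * inner_ell2 u x.
Proof.
rewrite -(cls_repr u) -(cls_repr x).
have -> : a *: cls Sg (repr x) = cls Sg (a *: (repr x : cseq)).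
  exact: scale_cls.
by rewrite !inner_ell2E semi_innerZr.
Qed.

Lemma inner_ell2Br (u x y : ell2 Sg) :
  inner_ell2 u (x - y) = inner_ell2 u x - inner_ell2 u y.
Proof. by rewrite -scaleN1r inner_ell2Dr inner_ell2Zr mulN1r. Qed.

Lemma inner_ell20 (u : ell2 Sg) : inner_ell2 u 0 = 0.
Proof. by rewrite -(scale0r 0) inner_ell2Zr mul0r. Qed.

Lemma norm_ell2_ge0 (x : ell2 Sg) : 0 <= norm_ell2 x.
Proof. by rewrite /norm_ell2 sqrtC_ge0 semi_inner_ge0. Qed.

Lemma norm_ell2_eq0 (x : ell2 Sg) : norm_ell2 x = 0 -> x = 0.
Proof.
move=> h; rewrite -(cls_repr x) -(cls_repr 0); apply/clsP.
(* The chosen representative of the zero class is only known to be a null sequence. *)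
have zero_null : nullseq Sg (repr (0 : ell2 Sg)).
  by rewrite /nullseq /semi_norm -inner_ell2E cls_repr inner_ell20 sqrtC0.
have x_null : nullseq Sg (repr x) by apply/eqP.
apply/eqP/nullseqP => k; rewrite !ffunE mulmxBr.
by rewrite (elimT (nullseqP _ _) x_null) (elimT (nullseqP _ _) zero_null) subrr.
Qed.

Lemma cauchy_schwarz (x y : ell2 Sg) :
  `|inner_ell2 x y| <= norm_ell2 x * norm_ell2 y.
Proof.
have [/norm_ell2_eq0 ->|yn0] := eqVneq (norm_ell2 y) 0.
  by rewrite inner_ell20 normr0 mulr_ge0 ?norm_ell2_ge0.
rewrite -(@ler_pXn2r _ 2) ?nnegrE ?mulr_ge0 ?norm_ell2_ge0 //.
rewrite exprMn !sqrtCK normCK.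
have : 0 < inner_ell2 y y.
  by rewrite lt_def semi_inner_ge0 andbT -sqrtC_eq0.
rewrite /inner_ell2; move: (repr x : cseq) (repr y : cseq) => u v.
rewrite [X in _ * X <= _](_ : _ = semi_inner Sg v u) => [Y0|]; last first.
  by rewrite [RHS]semi_innerC.
have := semi_inner_ge0 (semi_inner Sg v v *: u - semi_inner Sg v u *: v).
rewrite semi_innerBr !semi_innerZr !semi_innerBl !semi_innerZl.
have -> : conjC (semi_inner Sg v v) = semi_inner Sg v v by rewrite -semi_innerC.
have -> : conjC (semi_inner Sg v u) = semi_inner Sg u v by rewrite -semi_innerC.
by rewrite discriminant_identity pmulr_rge0 // subr_ge0.
Qed.

(** Adjoints are closed: subtracting the identity for an approximating [r] leaves terms in [p - r],
    which Cauchy-Schwarz makes arbitrarily small. *)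
Lemma closure_sub_adjoint (T' T : set (ell2 Sg * ell2 Sg)) :
  T' `<=` rel_adjoint T -> rel_closure T' `<=` rel_adjoint T.
Proof.
move=> hT p hp q hq; apply/eqP; rewrite -subr_eq0; set D := _ - _.
apply/eqP/(@small_eq0 _ _ (norm_ell2 q.1) (norm_ell2 q.2)).
- exact: norm_ell2_ge0.
- exact: norm_ell2_ge0.
move=> e e0; have [r [/hT /(_ q hq) hr r1 r2]] := hp _ e0.
have -> : D = inner_ell2 q.1 (p.2 - r.2) - inner_ell2 q.2 (p.1 - r.1).
  by rewrite !inner_ell2Br hr opprB addrA subrK.
apply: le_trans (ler_normB _ _) _; apply: lerD.
  apply: le_trans (cauchy_schwarz _ _) _.
  exact: ler_wpM2l (norm_ell2_ge0 _) _ _ (ltW r2).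
apply: le_trans (cauchy_schwarz _ _) _.
exact: ler_wpM2l (norm_ell2_ge0 _) _ _ (ltW r1).
Qed.

Lemma adjoint_linear_relation (T : set (ell2 Sg * ell2 Sg)) :
  linear_relation (rel_adjoint T).
Proof.
split=> [p _|a p q hp hq r hr] /=; first by rewrite !inner_ell20.
by rewrite !(inner_ell2Dr, inner_ell2Zr) hp // hq.
Qed.

(** [T] contains [T0], so its adjoint lies in [Tmax]; there, as all boundary values are attained,
    Green's formula turns membership into orthogonality to [K]. Being an adjoint, [T] is linear and
    closed, so it contains [Tmin]. *)
Lemma lagrangian_selfadjoint (K : 'cV[C]_2 -> 'cV[C]_2 -> Prop) :
  strong_Atkinson Sg -> lagrangian K ->
  selfadjoint_extension
    [set p | Tmax Sg p /\ K (hat p ord0) (hat p ord_max)] (Tmin Sg).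
Proof.
move=> sac hK; set T := [set p | _].
have TE : T = rel_adjoint T.
  apply/seteqP; split=> q.
    move=> [[v hv] Kq] p [[u hu] Kp]; apply/eqP; rewrite -subr_eq0.
    by rewrite (green_ell2 (hat_lift sac hu) (hat_lift sac hv)) (hK _ _).1.
  move=> hq.
  have [v hv] : Tmax Sg q.
    apply: T0_adjoint_sub_Tmax => // p [u [hu u0 uN]]; apply: hq; split.
      by exists u.
    rewrite (hat_unique sac hu) u0 uN; apply/hK => a b _.
    by rewrite /boundary_form !mulmx0 subrr.
  split; first by exists v.
  apply/hK => a b Kab.
  have [p [[u hu] pa pb]] := boundary_values_onto a b sac.
  rewrite -pa -pb -(green_ell2 (hat_lift sac hu) (hat_lift sac hv)).
  apply/eqP; rewrite subr_eq0; apply/eqP; apply: hq; split; first by exists u.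
  by rewrite pa pb.
split=> //; first by rewrite TE; exact: adjoint_linear_relation.
rewrite TE; apply: closure_sub_adjoint; rewrite -TE => p [u [hu u0 uN]].
split; first by exists u.
rewrite (hat_unique sac hu) u0 uN; apply/hK => a b _.
by rewrite /boundary_form !mulmx0 mxE subrr.
Qed.

End SelfAdjoint.

(** * Angles in [0, pi), unimodular numbers and isotropic rows *)

Section Angles.
Context {R : realType}.
Implicit Types x y alpha beta : R.

(** [r] may be negative, so only the line through (x, y) matters: the angle is the arctangent of the
    slope, raised by pi when negative. *)
Lemma polar_line x y : (x != 0) || (y != 0) ->
  exists2 alpha, 0 <= alpha < pi &
    exists2 r, r != 0 & x = r * cos alpha /\ y = r * sin alpha.
Proof.
have pi0 := pi_gt0 R.
have [-> /= y0|x0 _] := eqVneq x 0.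
  exists (pi / 2); first by apply/andP; split; lra.
  by exists y; rewrite // cos_pihalf sin_pihalf mulr0 mulr1.
pose t := atan (y / x).
have c0 : cos t != 0.
  by apply/lt0r_neq0/cos_gt0_pihalf; rewrite atan_gtNpi2 atan_ltpi2.
have tE : y = x / cos t * sin t.
  by rewrite -[_ / _ * _]mulrA [_^-1 * _]mulrC -[sin t / _]/(tan t) atanK mulrC divfK.
have t1 : - (pi / 2) < t := atan_gtNpi2 _.
have t2 : t < pi / 2 := atan_ltpi2 _.
have [t0|t0] := leP 0 t.
  exists t; first by apply/andP; split; lra.
  by exists (x / cos t); rewrite ?mulf_neq0 ?invr_eq0 // divfK.
exists (t + pi); first by apply/andP; split; lra.
exists (- (x / cos t)); first by rewrite oppr_eq0 mulf_neq0 ?invr_eq0.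
by rewrite cosDpi sinDpi !mulrNN divfK.
Qed.

Lemma angle_unique alpha beta : 0 <= alpha < pi -> 0 <= beta < pi ->
  sin alpha * cos beta = cos alpha * sin beta -> alpha = beta.
Proof.
move=> /andP[a0 a1] /andP[b0 b1] h.
have s0 : sin (alpha - beta) = 0 by rewrite sinB h subrr.
have [lt_ab|lt_ba|//] := ltgtP alpha beta.
  have : 0 < sin (beta - alpha) by apply: sin_gt0_pi; apply/andP; split; lra.
  by rewrite -opprB sinN s0 oppr0 ltxx.
have : 0 < sin (alpha - beta) by apply: sin_gt0_pi; apply/andP; split; lra.
by rewrite s0 ltxx.
Qed.

Lemma conjC_complex x y : conjC (x +i* y) = x +i* - y :> R[i].
Proof. by []. Qed.

Lemma conjC_fixed_real (w : R[i]) : conjC w = w -> w = (complex.Re w)%:C.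
Proof.
case: w => x y; rewrite conjC_complex => -[] h.
by congr (_ +i* _) => /=; lra.
Qed.

Definition cis beta : R[i] := cos beta +i* sin beta.

Lemma cis_mul_conj beta : cis beta * conjC (cis beta) = 1.
Proof.
rewrite conjC_complex; apply/eqP; rewrite eq_complex /=.
by rewrite mulrN opprK -!expr2 cos2Dsin2 eqxx /= mulrN [_ * cos _]mulrC addNr.
Qed.

(** A square root of [d] is unimodular, hence [cis beta] up to a sign, which disappears on
    squaring. *)
Lemma unit_sqrt_cis (d : R[i]) : d * conjC d = 1 ->
  exists2 beta, 0 <= beta < pi & cis beta ^+ 2 = d.
Proof.
move=> d1; pose w := sqrtC d; have wd : w ^+ 2 = d := sqrtCK d.
have w1 : w * conjC w = 1.
  have : (w * conjC w) ^+ 2 = 1 by rewrite exprMn -rmorphXn wd.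
  by move/eqP; rewrite sqrf_eq1 => /orP[/eqP //|/eqP h];
     have := mul_conjC_ge0 w; rewrite h oppr_ge0 ler10.
case: w w1 wd => x y; rewrite conjC_complex => -[h _] <-.
have [] := @polar_line x y.
  by apply: contraT; rewrite negb_or !negbK => /andP[/eqP x0 /eqP y0];
     move: h; rewrite x0 y0 !mul0r subr0 => /esym/eqP; rewrite oner_eq0.
move=> beta hb [r r0 [xE yE]]; exists beta => //.
have r2 : r ^+ 2 = 1.
  move: h; rewrite xE yE mulrN opprK => <-.
  have := cos2Dsin2 beta; move: (cos beta) (sin beta) => c s cs.
  by rewrite -[LHS]mulr1 -cs; ring.
have -> : x +i* y = r%:C * cis beta.
  by rewrite xE yE; apply/eqP; rewrite eq_complex /= !mul0r subr0 addr0 !eqxx.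
by rewrite exprMn -rmorphXn r2 mul1r.
Qed.

Lemma cis_sqr_inj alpha beta : 0 <= alpha < pi -> 0 <= beta < pi ->
  cis alpha ^+ 2 = cis beta ^+ 2 -> alpha = beta.
Proof.
move=> ha hb /eqP; rewrite eqf_sqr => h; apply: angle_unique => //.
by case/orP: h => /eqP[-> ->]; ring.
Qed.

(** Isotropy makes the quotient m_1 / m_0 its own conjugate, so the row is a complex multiple of a
    real one; m_0 = 0 gives the angle pi/2. *)
Lemma isotropic_row (m : 'rV[R[i]]_2) : m != 0 -> m *m J2 *m m^t* = 0 ->
  exists2 alpha, 0 <= alpha < pi & exists2 c, c != 0 &
    m 0 0 = c * (cos alpha)%:C /\ m 0 1 = c * (sin alpha)%:C.
Proof.
move=> m0 /matrixP/(_ 0 0); rewrite !mxE !big_ord_recl big_ord0 !mxE.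
rewrite !big_ord_recl !big_ord0 !mxE /=.
have -> : lift ord0 ord0 = 1 :> 'I_2 by apply: val_inj.
rewrite !(mulr0, mulr1, mulrN1, addr0, add0r) => iso.
have [p0|p0] := eqVneq (m 0 0) 0.
  exists (pi / 2); first by have := pi_gt0 R => ?; apply/andP; split; lra.
  exists (m 0 1); last by rewrite cos_pihalf sin_pihalf mulr0 mulr1.
  apply: contraNneq m0 => q0; apply/eqP/rowP => i; rewrite mxE.
  by case: i => [[|[|//]] ?]; [rewrite -[RHS]p0|rewrite -[RHS]q0];
     congr (m _ _); apply: val_inj.
have tr : conjC (m 0 1 / m 0 0) = m 0 1 / m 0 0.
  rewrite rmorphM fmorphV; apply/eqP.
  rewrite eqr_div ?conjC_eq0 // -subr_eq0 -iso mulrC; apply/eqP; ring.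
have := conjC_fixed_real tr; set t := complex.Re _ => tE.
have [|alpha ha [r r0 [xE yE]]] := @polar_line 1 t; first by rewrite oner_eq0.
exists alpha => //; exists (m 0 0 * r%:C).
  by rewrite mulf_neq0 // fmorph_eq0.
rewrite -!mulrA -!rmorphM -xE -yE rmorph1 mulr1; split=> //.
by transitivity (m 0 0 * (m 0 1 / m 0 0)); [rewrite mulrC divfK|congr (_ * _)].
Qed.

End Angles.

(** * Reduction of (M, L) in rank one and in rank two *)

Lemma rank1_factor {F : fieldType} (M : 'M[F]_2) : \rank M = 1%N ->
  exists (u : 'cV_2) (m : 'rV_2), m != 0 /\ M = u *m m.
Proof.
move=> r1; have := mulmx_base M; move: (col_base M) (row_base M).
rewrite r1 => u m ME; exists u, m; split=> //.
by apply/eqP => m0; move: r1; rewrite -ME m0 mulmx0 mxrank0.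
Qed.

(** With M = u m and L = v l, (M, L) = (u, v) diag(m, l) forces [W] = (u, v) to be invertible;
    cancelling it separates the endpoints, both in the form and in the boundary condition. *)
Lemma rank1_split {C : numClosedFieldType} (M L : 'M[C]_2) :
  \rank M = 1%N -> \rank L = 1%N -> \rank (row_mx M L) = 2%N ->
  M *m J2 *m M^t* - L *m J2 *m L^t* = 0 ->
  exists m l : 'rV[C]_2,
    [/\ m != 0 /\ m *m J2 *m m^t* = 0, l != 0 /\ l *m J2 *m l^t* = 0 &
        forall a b : 'cV_2, M *m a - L *m b = 0 <-> m *m a = 0 /\ l *m b = 0].
Proof.
move=> /rank1_factor [u [m [m0 ->]]] /rank1_factor [v [l [l0 ->]]] rk hML.
pose W : 'M[C]_2 := row_mx u v.
have Wu : W \in unitmx.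
  rewrite -row_free_unit /row_free eqn_leq rank_leq_row -{1}rk.
  have -> : row_mx (u *m m) (v *m l) = (row_mx u v) *m block_mx m 0 0 l.
    by rewrite mul_row_block !mulmx0 addr0 add0r.
  exact: mxrankM_maxl.
have WB (x y : 'M[C]_1) : row_mx u v *m block_mx x 0 0 y =
    row_mx (u *m x) (v *m y) by rewrite mul_row_block !mulmx0 addr0 add0r.
have : W *m (block_mx (m *m J2 *m m^t*) 0 0 (- (l *m J2 *m l^t*)) *m W^t*) = 0.
  have -> : W^t* = col_mx (u^t*) (v^t*)
    by rewrite -map_col_mx -(tr_row_mx u v).
  rewrite mulmxA WB mul_row_col -[RHS]hML !adjmxM.
  by rewrite !mulmxN !mulNmx !mulmxA.
move/(congr1 (mulmx (invmx W))); rewrite mulKmx // mulmx0.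
move/(congr1 (fun X => X *m invmx (W^t*))); rewrite mulmxK ?adjmx_unit // mul0mx.
rewrite -(block_mx0 _ 1 1 1 1) => /(@eq_block_mx _ 1 1 1 1) [mJ _ _ /eqP].
rewrite oppr_eq0 => /eqP lJ.
exists m, l; split=> // a b; split=> [h|[ha hb]]; last first.
  by rewrite -!mulmxA ha hb !mulmx0 subrr.
have : W *m col_mx (m *m a) (- (l *m b)) = 0.
  by rewrite [LHS](mul_row_col u v) mulmxN !mulmxA.
move/(congr1 (mulmx (invmx W))); rewrite mulKmx // mulmx0.
rewrite -(col_mx0 _ 1 1 1) => /(@eq_col_mx _ 1 1 1) [-> /eqP].
by rewrite oppr_eq0 => /eqP.
Qed.

Lemma det2E {A : comPzRingType} (X : 'M[A]_2) :
  \det X = X 0 0 * X 1 1 - X 0 1 * X 1 0.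
Proof.
rewrite (expand_det_row _ 0) !big_ord_recl big_ord0 /cofactor !det_mx11 !mxE /=.
rewrite addr0 /= expr0 mul1r expr1 mulN1r mulrN.
by congr (X _ _ * X _ _ - X _ _ * X _ _); apply: val_inj.
Qed.

Lemma ord2P (i : 'I_2) : i = 0 \/ i = 1.
Proof. by case: i => [[|[|//]] ?]; [left|right]; apply: val_inj. Qed.

Lemma tr_J2_mul {A : comPzRingType} (X : 'M[A]_2) :
  X^T *m J2 *m X = \det X *: J2.
Proof.
rewrite det2E; apply/matrixP => i j; rewrite !mxE !big_ord_recl !big_ord0 !mxE.
rewrite !big_ord_recl !big_ord0 !mxE /=.
have -> : lift ord0 ord0 = 1 :> 'I_2 by apply: val_inj.
by case: (ord2P i) => ->; case: (ord2P j) => -> /=; ring.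
Qed.

Lemma mul_J2_tr {A : comPzRingType} (X : 'M[A]_2) :
  X *m J2 *m X^T = \det X *: J2.
Proof. by rewrite -{1}[X]trmxK tr_J2_mul det_tr. Qed.

Lemma det_J2 {A : comPzRingType} : \det (J2 : 'M[A]_2) = 1.
Proof. by rewrite det2E !mxE /= mulr0 mulrN1 sub0r opprK. Qed.

Lemma symplectic_det {A : comPzRingType} (X : 'M[A]_2) :
  symplectic X <-> \det X = 1.
Proof.
rewrite /symplectic tr_J2_mul; split=> [|->]; last by rewrite scale1r.
by move/matrixP/(_ 0 1); rewrite !mxE /= mulr1.
Qed.

(** Determinant one also gives A J A^T = J, and the invertible [A *m J2] cancels. The conclusion
    says that [A] is real. *)
Lemma adjmx_eq_tr {C : numClosedFieldType} (A : 'M[C]_2) :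
  \det A = 1 -> A *m J2 *m A^t* = J2 -> A^t* = A^T.
Proof.
move=> dA AJ; have AJu : A *m J2 \in unitmx.
  by rewrite unitmxE det_mulmx dA det_J2 mulr1 unitr1.
have : A *m J2 *m A^t* = A *m J2 *m A^T by rewrite AJ mul_J2_tr dA scale1r.
by move/(congr1 (mulmx (invmx (A *m J2)))); rewrite !mulKmx.
Qed.

Lemma mulmx_cV_inj {A : pzRingType} m n (B D : 'M[A]_(m, n)) :
  (forall x : 'cV_n, B *m x = D *m x) -> B = D.
Proof.
by move=> h; apply/matrixP => i j; have /colP/(_ i) := h (delta_mx j 0);
   rewrite -!colE !mxE.
Qed.

(** In size two, dividing by a square root of the determinant normalises it to one; the sign of the
    root is absorbed in [A], so angles in [0, pi) suffice. *)
Lemma phase_symplectic {R : realType} (W : 'M[R[i]]_2) :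
  W *m J2 *m W^t* = J2 ->
  exists2 beta, 0 <= beta < pi &
    exists2 A : 'M[R]_2, symplectic A &
      W = cis beta *: map_mx (real_complex R) A.
Proof.
move=> hW.
have dW : \det W * conjC (\det W) = 1.
  have := congr1 (@determinant _ 2) hW; rewrite !det_mulmx det_J2 mulr1.
  by rewrite det_map_mx det_tr.
have [beta hb e2] := unit_sqrt_cis dW.
exists beta => //; set e := cis beta in e2 *.
have ee : e * conjC e = 1 := cis_mul_conj beta.
pose A := conjC e *: W.
have WA : W = e *: A by rewrite scalerA ee scale1r.
have dA : \det A = 1.
  by rewrite detZ -e2 -exprMn [_ * e]mulrC ee expr1n.
have AJ : A *m J2 *m A^t* = J2.
  rewrite /A adjmxZ -!scalemxAl -!scalemxAr scalerA conjCK [_ * e]mulrC ee.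
  by rewrite scale1r.
have Areal : A^t* = A^T := adjmx_eq_tr dA AJ.
pose A' : 'M[R]_2 := \matrix_(i, j) complex.Re (A i j).
have AE : A = map_mx (real_complex R) A'.
  apply/matrixP => i j; rewrite !mxE; apply: conjC_fixed_real.
  by have /matrixP/(_ j i) := Areal; rewrite !mxE.
exists A'; last by rewrite -AE.
apply/symplectic_det/(fmorph_inj (real_complex R)).
by rewrite -det_map_mx -AE dA rmorph1.
Qed.

Lemma rank2_split {R : realType} (M L : 'M[R[i]]_2) :
  \rank M = 2%N -> \rank L = 2%N -> M *m J2 *m M^t* - L *m J2 *m L^t* = 0 ->
  exists2 beta, 0 <= beta < pi &
    exists2 A : 'M[R]_2, symplectic A &
      forall a b : 'cV_2, M *m a - L *m b = 0 <->
        cis beta *: (map_mx (real_complex R) A *m a) = b.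
Proof.
move=> rM rL /eqP; rewrite subr_eq0 => /eqP hML.
have Lu : L \in unitmx by rewrite -row_free_unit /row_free rL.
have [|beta hb [A sA WE]] := @phase_symplectic _ (invmx L *m M).
  rewrite adjmxM !mulmxA -(mulmxA _ M) -(mulmxA _ (M *m J2)) hML !mulmxA.
  rewrite mulVmx // mul1mx -mulmxA -adjmxM mulVmx //.
  by rewrite adjmx1 mulmx1.
exists beta => //; exists A => // a b; rewrite scalemxAl -WE -mulmxA.
split=> [/eqP|<-]; last by rewrite mulKVmx // subrr.
by rewrite subr_eq0 => /eqP ->; rewrite mulKmx.
Qed.

(** Both real factors have determinant one, so determinants leave e^(2 i alpha) = e^(2 i beta). *)
Lemma phase_unique {R : realType} (alpha beta : R) (A B : 'M[R]_2) :
  0 <= alpha < pi -> 0 <= beta < pi -> symplectic A -> symplectic B ->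
  (forall a : 'cV_2, cis alpha *: (map_mx (real_complex R) A *m a) =
                     cis beta *: (map_mx (real_complex R) B *m a)) ->
  alpha = beta.
Proof.
move=> ha hb /symplectic_det dA /symplectic_det dB h.
have AB : cis alpha *: map_mx (real_complex R) A =
          cis beta *: map_mx (real_complex R) B.
  by apply: mulmx_cV_inj => a; rewrite -!scalemxAl.
apply: cis_sqr_inj => //; have := congr1 (@determinant _ 2) AB.
by rewrite !detZ !det_map_mx dA dB !rmorph1 !mulr1.
Qed.

(** * The conditions given by [Pmx] and [Qmx], and uniqueness of the parameters *)

Lemma mul_row2 {A : comPzRingType} (m : 'rV[A]_2) (a : 'cV[A]_2) :
  m *m a = 0 <-> m 0 0 * a 0 0 + m 0 1 * a 1 0 = 0.
Proof.
have E : (m *m a) 0 0 = m 0 0 * a 0 0 + m 0 1 * a 1 0.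
  rewrite !mxE !big_ord_recl big_ord0 addr0.
  by have -> : lift ord0 ord0 = 1 :> 'I_2 by apply: val_inj.
split=> [ma|ma]; first by rewrite -E ma mxE.
by apply/matrixP => i j; rewrite !ord1 E ma mxE.
Qed.

Lemma Pmx_mul {R : realType} (alpha : R) (a : 'cV[R[i]]_2) :
  Pmx alpha *m a = 0 <->
  (cos alpha)%:C * a 0 0 + (sin alpha)%:C * a 1 0 = 0.
Proof.
have l1 : lift ord0 ord0 = 1 :> 'I_2 by apply: val_inj.
split=> [/matrixP/(_ 0 0)|h].
  by rewrite !mxE !big_ord_recl big_ord0 !mxE /= addr0 l1.
apply/matrixP => i j; rewrite ord1 !mxE !big_ord_recl big_ord0 !mxE /= addr0 l1.
by case: i => [[|[|//]] ?] //=; rewrite !mul0r addr0.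
Qed.

Lemma Qmx_mul {R : realType} (alpha : R) (a : 'cV[R[i]]_2) :
  0 = Qmx alpha *m a <->
  - (sin alpha)%:C * a 0 0 + (cos alpha)%:C * a 1 0 = 0.
Proof.
have l1 : lift ord0 ord0 = 1 :> 'I_2 by apply: val_inj.
split=> [/esym/matrixP/(_ 1 0)|h].
  by rewrite !mxE !big_ord_recl big_ord0 !mxE /= addr0 l1 rmorphN.
apply/esym/matrixP => i j.
rewrite ord1 !mxE !big_ord_recl big_ord0 !mxE /= addr0 l1.
by case: i => [[|[|//]] ?] //=; rewrite ?rmorphN // !mul0r addr0.
Qed.

(** Every (a, b) is the boundary value of a pair in [Tmax], whose membership decides the condition
    at (a, b). *)
Lemma boundary_set_inj {R : realType} {N : nat} (Sg : symp_system R N)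
    (K K' : 'cV[R[i]]_2 -> 'cV[R[i]]_2 -> Prop) :
  strong_Atkinson Sg ->
  [set p | Tmax Sg p /\ K (hat p ord0) (hat p ord_max)] =
  [set p | Tmax Sg p /\ K' (hat p ord0) (hat p ord_max)] ->
  forall a b, K a b <-> K' a b.
Proof.
move=> sac h a b; have [p [hp <- <-]] := boundary_values_onto a b sac.
have /= := congr1 (@^~ p) h => E.
by split=> k; have := conj hp k; [rewrite E|rewrite -E]; case.
Qed.

Lemma T_PQE {R : realType} {N : nat} (Sg : symp_system R N) (P Q : 'M[R[i]]_2) :
  T_PQ Sg P Q = [set p | Tmax Sg p /\
    (P *m hat p ord0 = 0 /\ 0 = Q *m hat p ord_max)].
Proof. by apply/seteqP; split=> p => [[? ? ?]|[? [? ?]]]; split. Qed.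

Lemma isotropic_row_Pmx {R : realType} (m : 'rV[R[i]]_2) :
  m != 0 -> m *m J2 *m m^t* = 0 ->
  exists2 alpha : R, 0 <= alpha < pi &
    forall a : 'cV_2, m *m a = 0 <-> Pmx alpha *m a = 0.
Proof.
move=> m0 /(isotropic_row m0) [alpha ha [c c0 [m0E m1E]]].
exists alpha => // a; rewrite Pmx_mul mul_row2 m0E m1E -!mulrA -mulrDr.
split=> [/eqP|->]; last by rewrite mulr0.
by rewrite mulf_eq0 (negPf c0) => /eqP.
Qed.

(** J turns the row (-sin, cos) of [Qmx] into -(cos, sin), so the angle is read off [l *m J2], which
    is again isotropic. *)
Lemma isotropic_row_Qmx {R : realType} (l : 'rV[R[i]]_2) :
  l != 0 -> l *m J2 *m l^t* = 0 ->
  exists2 alpha : R, 0 <= alpha < pi &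
    forall b : 'cV_2, l *m b = 0 <-> 0 = Qmx alpha *m b.
Proof.
move=> l0 lJ; have lJ0 : l *m J2 != 0.
  apply: contraNneq l0 => h; have := mulmxA l J2 J2.
  by rewrite h J2K mulmxN mulmx1 mul0mx => /eqP; rewrite oppr_eq0.
have lJJ : l *m J2 *m J2 *m (l *m J2)^t* = 0.
  rewrite adjmxM adjmx_J2 -!mulmxA mulNmx !mulmxN J2KM mulmxN opprK.
  by rewrite mulmxA.
have [alpha ha [c c0 [l1E l0E]]] := isotropic_row lJ0 lJJ.
have lE0 : l 0 1 = - (c * (cos alpha)%:C).
  rewrite -l1E !mxE !big_ord_recl big_ord0 !mxE /= mulr0 add0r addr0 mulrN1.
  by rewrite opprK; congr (l _ _); apply: val_inj.
have lE1 : l 0 0 = c * (sin alpha)%:C.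
  by rewrite -l0E !mxE !big_ord_recl big_ord0 !mxE /= mulr0 mulr1 !addr0.
exists alpha => // b; rewrite Qmx_mul mul_row2 lE0 lE1.
rewrite [X in X = 0 <-> _](_ : _ =
  - c * (- (sin alpha)%:C * b 0 0 + (cos alpha)%:C * b 1 0)).
  split=> [/eqP|h]; last by rewrite h mulr0.
  by rewrite mulf_eq0 oppr_eq0 (negPf c0) => /eqP.
by rewrite mulrDr !mulrA !mulrNN !mulNr.
Qed.

(** Each angle is tested with the other boundary value zero, on a vector spanning the kernel: (sin,
    -cos) for [Pmx], (cos, sin) for [Qmx]. *)
Lemma pair_relation_unique {R : realType} (alpha beta : R * R) :
  0 <= alpha.1 < pi -> 0 <= alpha.2 < pi ->
  0 <= beta.1 < pi -> 0 <= beta.2 < pi ->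
  (forall a b : 'cV[R[i]]_2,
    Pmx alpha.1 *m a = 0 /\ 0 = Qmx alpha.2 *m b <->
    Pmx beta.1 *m a = 0 /\ 0 = Qmx beta.2 *m b) ->
  alpha = beta.
Proof.
case: alpha beta => [a1 a2] [b1 b2] /= ha1 ha2 hb1 hb2 h.
pose v (x y : R) : 'cV[R[i]]_2 := \col_i (if i == 0 then x%:C else y%:C).
have realE (x y z t : R) : x%:C * z%:C + y%:C * t%:C = 0 -> x * z + y * t = 0.
  by rewrite -!rmorphM -rmorphD => /eqP; rewrite fmorph_eq0 => /eqP.
have cE (x y z t : R) : x * z + y * t = 0 -> x%:C * z%:C + y%:C * t%:C = 0.
  by rewrite -!rmorphM -rmorphD => ->; rewrite rmorph0.
congr (_, _); apply: angle_unique => //.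
  have [/(_ _)[]] := h (v (sin a1) (- cos a1)) 0.
    split; last by rewrite mulmx0.
    by apply/Pmx_mul; rewrite !mxE /=; apply: cE; ring.
  by move/Pmx_mul; rewrite !mxE /= => /realE; lra.
have [/(_ _)[]] := h 0 (v (cos a2) (sin a2)).
  split; first by rewrite mulmx0.
  by apply/Qmx_mul; rewrite !mxE /= -rmorphN; apply: cE; ring.
by move=> _ /Qmx_mul; rewrite !mxE /= -rmorphN => /realE; lra.
Qed.

Theorem theorem3p9 (R : realType) (N : nat) (Sg : symp_system R N)
  (M L : 'M[R[i]]_2) :
  strong_Atkinson Sg ->
  \rank (row_mx M L) = 2%N ->
  M *m J2 *m M ^t* - L *m J2 *m L ^t* = 0 ->
  (\rank M = 1%N -> \rank L = 1%N ->
     (selfadjoint_extension (T_ML Sg M L) (Tmin Sg) <->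
      exists! alpha : R * R,
        [/\ 0 <= alpha.1 < pi, 0 <= alpha.2 < pi &
            T_ML Sg M L = T_PQ Sg (Pmx alpha.1) (Qmx alpha.2)])) /\
  (\rank M = 2%N -> \rank L = 2%N ->
     (selfadjoint_extension (T_ML Sg M L) (Tmin Sg) <->
      exists! beta : R,
        0 <= beta < pi /\
        exists A : 'M[R]_2, symplectic A /\
          T_ML Sg M L = T_Rbeta Sg A beta)).
Proof.
move=> sac rk hML.
have sa : selfadjoint_extension (T_ML Sg M L) (Tmin Sg).
  exact: lagrangian_selfadjoint sac (kernel_lagrangian rk hML).
(* [sa] settles one direction of each equivalence; existence and uniqueness of the parameters
   remain. *)
split=> rM rL; split=> // _.
  have [m [l [[m0 mJ] [l0 lJ] split_ml]]] := rank1_split rM rL rk hML.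
  have [a1 ha1 mP] := isotropic_row_Pmx m0 mJ.
  have [a2 ha2 lQ] := isotropic_row_Qmx l0 lJ.
  have TE : T_ML Sg M L = T_PQ Sg (Pmx a1) (Qmx a2).
    rewrite T_PQE; apply/seteqP; split=> p [hp].
      by move=> /split_ml[/mP ? /lQ ?].
    by move=> [/mP ? /lQ ?]; split=> //; apply/split_ml.
  exists (a1, a2); split=> [|beta [hb1 hb2 TE']]; first by split.
  apply: pair_relation_unique => // a b.
  have := etrans (esym TE) TE'; rewrite !T_PQE => TPQ.
  exact: (boundary_set_inj sac
    (K := fun a b => Pmx a1 *m a = 0 /\ 0 = Qmx a2 *m b)
    (K' := fun a b => Pmx beta.1 *m a = 0 /\ 0 = Qmx beta.2 *m b) TPQ).
have [beta hb [A sA split_A]] := rank2_split rM rL hML.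
have TE : T_ML Sg M L = T_Rbeta Sg A beta.
  by apply/seteqP; split=> p [hp /split_A].
exists beta; split=> [|beta' [hb' [A' [sA' TE']]]].
  by split=> //; exists A.
apply: phase_unique sA sA' _ => // a.
pose K g (B : 'M[R]_2) (a b : 'cV[R[i]]_2) :=
  cis g *: (map_mx (real_complex R) B *m a) = b.
(* Tested on [a] and its image under the first condition, which [K beta A] relates by definition. *)
have [K_sub _] := boundary_set_inj sac
  (K := K beta A) (K' := K beta' A') (etrans (esym TE) TE') a
  (cis beta *: (map_mx (real_complex R) A *m a)).
exact: esym (K_sub erefl).
Qed.
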